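(* Consider the $D_4^{(1)}$ system (defined in the context) restricted to parameters with $\alpha_4=\alpha_3=\alpha_1$, and set $\beta_0:=\alpha_0$, $\beta_1:=\alpha_2$, $\beta_2:=\alpha_3$, so that $\beta_0+2\beta_1+3\beta_2=1$. This system has the following invariant divisors: if $\beta_0=0$, then $f_0:=x-\eta$ is an invariant divisor; if $\beta_1=0$, then $f_1:=z$ is; if $\beta_2=0$, then $f_2:=xy(y-1)$ is.
   Context: A polynomial $f$ in $x,y,z$ is an invariant divisor of a polynomial system if the derivative $df/dt$ along the system equals $f$ times a polynomial in $x,y,z$ (with coefficients in $\mathbb{C}(t)$). The $D_4^{(1)}$ system. Let $\eta\in\mathbb{C}\setminus\{0\}$, let $b(t)\in\mathbb{C}(t)$ be nonzero, and let $\alpha_0,\dots,\alpha_4\in\mathbb{C}$ satisfy $\alpha_0+\alpha_1+2\alpha_2+\alpha_3+\alpha_4=1$. The $D_4^{(1)}$ system for unknown functions $x,y,z$ of $t$ is $$\frac{2\eta}{b(t)}\frac{dx}{dt}=P,\qquad -\frac{2\eta}{b(t)}\frac{dy}{dt}=Q,\qquad \frac{2\eta}{b(t)}\frac{dz}{dt}=R,$$ where $P=-2x(y-1)yz(x-\eta)(2x-2y+1-\eta)-2(2\alpha_0+2\alpha_1+4\alpha_2+\alpha_3+\alpha_4)x^3y-2(\alpha_0+\alpha_1)xy^3+(5\alpha_0+5\alpha_1+6\alpha_2+\alpha_3+\alpha_4)x^2y^2-\{5\alpha_0+5\alpha_1+6\alpha_2+2\alpha_3-3(2\alpha_0+2\alpha_1+4\alpha_2+\alpha_3+\alpha_4)\eta\}x^2y+\{3(\alpha_0+\alpha_1)-(4\alpha_0+6\alpha_1+6\alpha_2+\alpha_3+\alpha_4)\eta\}xy^2+x^4+2(\alpha_0+\alpha_1+2\alpha_2+\alpha_3-\eta)x^3+2\alpha_1\eta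 y^3+\{(\alpha_0+\alpha_1+2\alpha_2+\alpha_3)(\eta^2-3\eta+1)+\alpha_4\eta^2\}x^2+\alpha_1(\eta-3)\eta y^2+\{-(\alpha_0+\alpha_1)+2(2\alpha_0+3\alpha_1+3\alpha_2+\alpha_3)\eta-(2\alpha_0+2\alpha_1+4\alpha_2+\alpha_3+\alpha_4)\eta^2\}xy+(\alpha_0+\alpha_1+2\alpha_2+\alpha_3)(\eta-1)\eta x-\alpha_1(\eta-1)\eta y$, $Q=2x(y-1)yz(x-\eta)(2x-2y+1-\eta)-2(\alpha_3+\alpha_4)x^3y-2(\alpha_0+\alpha_1+4\alpha_2+2\alpha_3+2\alpha_4)xy^3+(\alpha_0+\alpha_1+6\alpha_2+5\alpha_3+5\alpha_4)x^2y^2+\{-(\alpha_0+\alpha_1+6\alpha_2+4\alpha_3+6\alpha_4)+3(\alpha_3+\alpha_4)\eta\}x^2y+\{3(\alpha_0+\alpha_1+4\alpha_2+2\alpha_3+2\alpha_4)-(2\alpha_0+6\alpha_2+5\alpha_3+5\alpha_4)\eta\}xy^2+y^4+2\alpha_4x^3+2\{(\alpha_0+2\alpha_2+\alpha_3+\alpha_4)\eta-1\}y^3-\alpha_4(3\eta-1)x^2+\{1-3(\alpha_0+2\alpha_2+\alpha_3+\alpha_4)\eta+(\alpha_0+2\alpha_2+\alpha_3+\alpha_4)\eta^2\}y^2+\{-(\alpha_0+\alpha_1+4\alpha_2+2\alpha_3+2\alpha_4)+2(\alpha_0+3\alpha_2+2\alpha_3+3\alpha_4)\eta-(\alpha_3+\alpha_4)\eta^2\}xy+\alpha_4(\eta-1)\eta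 x-(\alpha_0+2\alpha_2+\alpha_3+\alpha_4)(\eta-1)\eta y$, $R=(2x-2y+1-\eta)\{2x^2y+2xy^2-x^2-\eta y^2-2(\eta+1)xy+\eta(x+y)\}z^2+z\big[-2(\alpha_3+\alpha_4)x^3+2(\alpha_0+\alpha_1)y^3+2(\alpha_0+\alpha_1+6\alpha_2+2\alpha_3+2\alpha_4)x^2y-2(2\alpha_0+2\alpha_1+6\alpha_2+\alpha_3+\alpha_4)xy^2+\{-(\alpha_0+\alpha_1+6\alpha_2+4\alpha_3)+3(\alpha_3+\alpha_4)\eta\}x^2+\{-3(\alpha_0+\alpha_1)+(4\alpha_0+6\alpha_2+\alpha_3+\alpha_4)\eta\}y^2-4\{-(\alpha_0+\alpha_1+3\alpha_2+\alpha_3)+(\alpha_0+3\alpha_2+\alpha_3+\alpha_4)\eta\}xy+\{-(\alpha_0+\alpha_1+4\alpha_2+2\alpha_3)+2(\alpha_0+3\alpha_2+2\alpha_3)\eta-(\alpha_3+\alpha_4)\eta^2\}x+\{\alpha_0+\alpha_1-2(2\alpha_0+3\alpha_2+\alpha_3)\eta+(2\alpha_0+4\alpha_2+\alpha_3+\alpha_4)\eta^2\}y-(\alpha_0+2\alpha_2+\alpha_3)(\eta-1)\eta\big]+\alpha_2\big[(\alpha_0+\alpha_1+2\alpha_2-\alpha_3-\alpha_4)x^2+(\alpha_0+\alpha_1-2\alpha_2-\alpha_3-\alpha_4)y^2-2(\alpha_0+\alpha_1-\alpha_3-\alpha_4)xy+\{\alpha_0+\alpha_1-2\alpha_3-(2\alpha_0+2\alpha_2-\alpha_3-\alpha_4)\eta\}x+\{-\alpha_0-\alpha_1+2\alpha_2+2\alpha_3+(2\alpha_0-\alpha_3-\alpha_4)\eta\}y+(\eta-1)(\alpha_2+\alpha_3+(\alpha_0+\alpha_2)\eta)\big]$.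 *)

(* Defs.v *)
From HB Require Import structures.
From mathcomp Require Import all_boot all_order all_algebra.
From mathcomp Require Import reals complex mpoly ring.

Set Implicit Arguments.
Unset Strict Implicit.
Unset Printing Implicit Defensive.

Import GRing.Theory.
Local Open Scope ring_scope.
Local Open Scope quotient_scope.

(* Rational functions in t over a field C; for C := R[i] with R : realType this
   is the field of rational functions with complex coefficients. *)
Notation ratfun C := {fraction {poly C}}.

Fact quotient_rule_eq (A : comNzRingType) (p q n d p' q' n' d' : A) :
  p * d = n * q -> p' * d + p * d' = n' * q + n * q' ->
  (n' * d - n * d') * q ^+ 2 = (p' * q - p * q') * d ^+ 2.
Proof.
move=> /eqP; rewrite -subr_eq0 => /eqP e1 /eqP.
rewrite -subr_eq0 => /eqP e2; apply/eqP; rewrite -subr_eq0; apply/eqP.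
transitivity ((d' * q + q' * d) * (p * d - n * q)
              - d * q * (p' * d + p * d' - (n' * q + n * q'))); first by ring.
by rewrite e1 e2 !mulr0 subr0.
Qed.

Section Derivation.
Variable C : fieldType.
Implicit Types (a : ratfun C) (p q : {poly C}).

(* d/dt on rational functions, by the quotient rule applied to the chosen
   representative; ratderivE shows that the representative is irrelevant. *)
Definition ratderiv a : ratfun C :=
  let p := \n_(repr a) in let q := \d_(repr a) in
  tofrac (p^`() * q - p * q^`()) / tofrac (q ^+ 2).

Lemma ratderivE p q : q != 0 ->
  ratderiv (tofrac p / tofrac q) =
    tofrac (p^`() * q - p * q^`()) / tofrac (q ^+ 2).
Proof.
move=> q0; set a := tofrac p / tofrac q; rewrite /ratderiv.
set r := repr a; have d0 : \d_r != 0 by exact: denom_ratioP.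
have aE : a = tofrac \n_r / tofrac \d_r.
  have E (s : {ratio {poly C}}) : \pi_(ratfun C) s = tofrac \n_s / tofrac \d_s.
    have s0 : tofrac \d_s != 0 by rewrite tofrac_eq0 denom_ratioP.
    apply: (mulIf s0); rewrite divfK // !piE; apply/eqmodP => /=.
    rewrite FracField.equivfE /FracField.mulf !numden_Ratio ?oner_neq0 //.
      by rewrite !mulr1 mulrC.
      by rewrite mulr1 denom_ratioP.
    by rewrite mulr1 denom_ratioP.
  by rewrite -E /r reprK.
have npq : p * \d_r = \n_r * q.
  apply/eqP; rewrite -tofrac_eq !tofracM.
  by rewrite -eqr_div ?tofrac_eq0 // -/a aE.
have dpq : p^`() * \d_r + p * (\d_r)^`() = (\n_r)^`() * q + \n_r * q^`().
  by rewrite -!derivM npq.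
apply/eqP; rewrite eqr_div ?tofrac_eq0 ?expf_eq0 // -!tofracM tofrac_eq.
apply/eqP; exact: quotient_rule_eq npq dpq.
Qed.

(* The derivative of f in C(t)[x_1, .., x_n] along the system dx_i/dt = v_i:
   the coefficients of f are differentiated too. *)
Definition flow_deriv n (v : 'I_n -> {mpoly (ratfun C)[n]})
    (f : {mpoly (ratfun C)[n]}) : {mpoly (ratfun C)[n]} :=
  map_mpoly ratderiv f + \sum_(i < n) v i * f^`M(i).

Definition invariant_divisor n (v : 'I_n -> {mpoly (ratfun C)[n]})
    (f : {mpoly (ratfun C)[n]}) : Prop :=
  exists g : {mpoly (ratfun C)[n]}, flow_deriv v f = f * g.

End Derivation.

Section RightHandSides.
Variables (A : comNzRingType) (eta a0 a1 a2 a3 a4 x y z : A).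

Definition D4_P : A :=
  - 2 * x * (y - 1) * y * z * (x - eta) * (2 * x - 2 * y + 1 - eta)
  - 2 * (2 * a0 + 2 * a1 + 4 * a2 + a3 + a4) * x ^+ 3 * y
  - 2 * (a0 + a1) * x * y ^+ 3
  + (5 * a0 + 5 * a1 + 6 * a2 + a3 + a4) * x ^+ 2 * y ^+ 2
  - (5 * a0 + 5 * a1 + 6 * a2 + 2 * a3
     - 3 * (2 * a0 + 2 * a1 + 4 * a2 + a3 + a4) * eta) * x ^+ 2 * y
  + (3 * (a0 + a1) - (4 * a0 + 6 * a1 + 6 * a2 + a3 + a4) * eta) * x * y ^+ 2
  + x ^+ 4
  + 2 * (a0 + a1 + 2 * a2 + a3 - eta) * x ^+ 3
  + 2 * a1 * eta * y ^+ 3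
  + ((a0 + a1 + 2 * a2 + a3) * (eta ^+ 2 - 3 * eta + 1) + a4 * eta ^+ 2)
    * x ^+ 2
  + a1 * (eta - 3) * eta * y ^+ 2
  + (- (a0 + a1) + 2 * (2 * a0 + 3 * a1 + 3 * a2 + a3) * eta
     - (2 * a0 + 2 * a1 + 4 * a2 + a3 + a4) * eta ^+ 2) * x * y
  + (a0 + a1 + 2 * a2 + a3) * (eta - 1) * eta * x
  - a1 * (eta - 1) * eta * y.

Definition D4_Q : A :=
  2 * x * (y - 1) * y * z * (x - eta) * (2 * x - 2 * y + 1 - eta)
  - 2 * (a3 + a4) * x ^+ 3 * y
  - 2 * (a0 + a1 + 4 * a2 + 2 * a3 + 2 * a4) * x * y ^+ 3
  + (a0 + a1 + 6 * a2 + 5 * a3 + 5 * a4) * x ^+ 2 * y ^+ 2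
  + (- (a0 + a1 + 6 * a2 + 4 * a3 + 6 * a4) + 3 * (a3 + a4) * eta)
    * x ^+ 2 * y
  + (3 * (a0 + a1 + 4 * a2 + 2 * a3 + 2 * a4)
     - (2 * a0 + 6 * a2 + 5 * a3 + 5 * a4) * eta) * x * y ^+ 2
  + y ^+ 4
  + 2 * a4 * x ^+ 3
  + 2 * ((a0 + 2 * a2 + a3 + a4) * eta - 1) * y ^+ 3
  - a4 * (3 * eta - 1) * x ^+ 2
  + (1 - 3 * (a0 + 2 * a2 + a3 + a4) * eta
     + (a0 + 2 * a2 + a3 + a4) * eta ^+ 2) * y ^+ 2
  + (- (a0 + a1 + 4 * a2 + 2 * a3 + 2 * a4)
     + 2 * (a0 + 3 * a2 + 2 * a3 + 3 * a4) * eta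
     - (a3 + a4) * eta ^+ 2) * x * y
  + a4 * (eta - 1) * eta * x
  - (a0 + 2 * a2 + a3 + a4) * (eta - 1) * eta * y.

Definition D4_R : A :=
  (2 * x - 2 * y + 1 - eta)
  * (2 * x ^+ 2 * y + 2 * x * y ^+ 2 - x ^+ 2 - eta * y ^+ 2
     - 2 * (eta + 1) * x * y + eta * (x + y)) * z ^+ 2
  + z * (- 2 * (a3 + a4) * x ^+ 3
         + 2 * (a0 + a1) * y ^+ 3
         + 2 * (a0 + a1 + 6 * a2 + 2 * a3 + 2 * a4) * x ^+ 2 * y
         - 2 * (2 * a0 + 2 * a1 + 6 * a2 + a3 + a4) * x * y ^+ 2
         + (- (a0 + a1 + 6 * a2 + 4 * a3) + 3 * (a3 + a4) * eta) * x ^+ 2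
         + (- 3 * (a0 + a1) + (4 * a0 + 6 * a2 + a3 + a4) * eta) * y ^+ 2
         - 4 * (- (a0 + a1 + 3 * a2 + a3) + (a0 + 3 * a2 + a3 + a4) * eta)
           * x * y
         + (- (a0 + a1 + 4 * a2 + 2 * a3)
            + 2 * (a0 + 3 * a2 + 2 * a3) * eta
            - (a3 + a4) * eta ^+ 2) * x
         + (a0 + a1 - 2 * (2 * a0 + 3 * a2 + a3) * eta
            + (2 * a0 + 4 * a2 + a3 + a4) * eta ^+ 2) * y
         - (a0 + 2 * a2 + a3) * (eta - 1) * eta)
  + a2 * ((a0 + a1 + 2 * a2 - a3 - a4) * x ^+ 2
          + (a0 + a1 - 2 * a2 - a3 - a4) * y ^+ 2
          - 2 * (a0 + a1 - a3 - a4) * x * y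
          + (a0 + a1 - 2 * a3 - (2 * a0 + 2 * a2 - a3 - a4) * eta) * x
          + (- a0 - a1 + 2 * a2 + 2 * a3 + (2 * a0 - a3 - a4) * eta) * y
          + (eta - 1) * (a2 + a3 + (a0 + a2) * eta)).

End RightHandSides.

Section D4System.
Variable C : fieldType.

Definition ratC (c : C) : ratfun C := tofrac c%:P.

Definition constC (c : C) : {mpoly (ratfun C)[3]} := (ratC c)%:MP.

Definition varx : {mpoly (ratfun C)[3]} := 'X_(@Ordinal 3 0 isT).
Definition vary : {mpoly (ratfun C)[3]} := 'X_(@Ordinal 3 1 isT).
Definition varz : {mpoly (ratfun C)[3]} := 'X_(@Ordinal 3 2 isT).

(* The vector field (dx/dt, dy/dt, dz/dt), solved from
   (2 eta / b) dx/dt = P, - (2 eta / b) dy/dt = Q, (2 eta / b) dz/dt = R. *)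
Definition D4_system (eta : C) (b : ratfun C) (a0 a1 a2 a3 a4 : C) :
    'I_3 -> {mpoly (ratfun C)[3]} :=
  let rhs (F : forall A : comNzRingType,
                 A -> A -> A -> A -> A -> A -> A -> A -> A -> A) :=
    F _ (constC eta) (constC a0) (constC a1) (constC a2) (constC a3)
      (constC a4) varx vary varz in
  let k := b / (2 * ratC eta) in
  tnth [tuple k *: rhs (@D4_P); (- k) *: rhs (@D4_Q); k *: rhs (@D4_R)].

End D4System.

(* Main.v *)
Require Import Defs.
From HB Require Import structures.
From mathcomp Require Import all_boot all_order all_algebra.
From mathcomp Require Import reals complex mpoly.
From mathcomp Require Import ring.

Set Implicit Arguments.
Unset Strict Implicit.
Unset Printing Implicit Defensive.

Import GRing.Theory.
Local Open Scope ring_scope.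
Local Open Scope complex_scope.

(** All the divisors in question have coefficients that do not depend on t, so
    d/dt acts on them only through the vector field v, as the derivation
    \sum_i v_i d/dx_i ([flow_deriv_autonomous]).  Consequently x_i - c is an
    invariant divisor as soon as it divides v_i
    ([invariant_divisor_hyperplane]), and by the Leibniz rule a product of
    invariant divisors is one, the cofactors adding up ([invariant_divisorM]).
    The latter reduces xy(y - 1) to its three factors.

    It remains to see that x - eta divides P, that z divides R, and that x
    divides P while y and y - 1 divide Q, in the respective cases.  These are
    polynomial identities, and the cofactors are explicit ([D4_P_a0],
    [D4_R_a2], [D4_P_a134], [D4_Q_a134]).  For z this only says that alpha_2
    multiplies the z-free part of R; the other identities hold modulo the
    normalization of the parameters.  Indeed P and Q would be homogeneous of
    degree 1 in z and the alphas, were it not for terms such as x^4 in P, free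
    of both, which carry
    alpha_0 + alpha_1 + 2 alpha_2 + alpha_3 + alpha_4 replaced by 1. *)

(** * Invariant divisors with constant coefficients *)

Section AutonomousDivisors.
Variables (C : fieldType) (n : nat).
Implicit Types (f g : {mpoly (ratfun C)[n]}).
Implicit Types (v : 'I_n -> {mpoly (ratfun C)[n]}).

(** Membership in the image of C[x_1, .., x_n] is chosen over the vanishing of
    the derivatives of the coefficients: closure under products then comes from
    a ring morphism instead of the product rule for [ratderiv]. *)
Definition autonomous f : Prop :=
  exists p : {mpoly C[n]}, f = map_mpoly (@tofrac {poly C} \o polyC) p.

Lemma autonomousM f g : autonomous f -> autonomous g -> autonomous (f * g).
Proof. by move=> [p ->] [q ->]; exists (p * q); rewrite rmorphM. Qed.

Lemma autonomous_hyperplane (i : 'I_n) (c : C) :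
  autonomous ('X_i - (ratC c)%:MP).
Proof.
by exists ('X_i - c%:MP); rewrite rmorphB /= map_mpolyX map_mpolyC.
Qed.

Lemma ratderiv_const (c : C) : ratderiv (ratC c) = 0.
Proof.
rewrite /ratC -[tofrac _]divr1 -tofrac1 ratderivE ?oner_neq0 //.
by rewrite !derivC mul0r mulr0 subr0 tofrac0 mul0r.
Qed.

Lemma flow_deriv_autonomous v f :
  autonomous f -> flow_deriv v f = \sum_(i < n) v i * f^`M(i).
Proof.
case=> p ->; rewrite /flow_deriv [X in X + _](_ : _ = 0) ?add0r //.
(* The sum is unfolded over the support because [ratderiv] carries no additive
   structure. *)
rewrite {1}/map_mpoly /mmap big1 // => m _ /=.
by rewrite mcoeff_map_mpoly /= ratderiv_const mpolyC0 mul0r.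
Qed.

Lemma invariant_divisorM v f g : autonomous f -> autonomous g ->
  invariant_divisor v f -> invariant_divisor v g -> invariant_divisor v (f * g).
Proof.
move=> fA gA [h fE] [k gE]; exists (h + k).
rewrite flow_deriv_autonomous; last exact: autonomousM.
transitivity (flow_deriv v f * g + f * flow_deriv v g).
  rewrite !flow_deriv_autonomous // mulr_suml mulr_sumr -big_split.
  by apply: eq_bigr => i _ /=; rewrite mderivM mulrDr mulrA [in RHS]mulrCA.
by rewrite fE gE mulrDr mulrAC mulrA.
Qed.

(** Along the flow, the derivative of x_i - c is the i-th component v_i. *)
Lemma invariant_divisor_hyperplane v (i : 'I_n) (c : C)
    (g : {mpoly (ratfun C)[n]}) :
  v i = ('X_i - (ratC c)%:MP) * g ->
  invariant_divisor v ('X_i - (ratC c)%:MP).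
Proof.
move=> vE; exists g; rewrite flow_deriv_autonomous; last first.
  exact: autonomous_hyperplane.
rewrite (bigD1 i) //= big1 => [|j ji].
  rewrite addr0 {}vE mderivB mderivC subr0 mderivX mnmE eqxx.
  have -> : (U_(i) - U_(i) = 0%MM :> 'X_{1..n})%MM.
    by apply/mnmP=> k; rewrite !mnmE subnn.
  by rewrite mpolyX0 scale1r mulr1.
by rewrite mderivB mderivC subr0 mderivX mnmE eq_sym (negPf ji) scale0r mulr0.
Qed.

Lemma autonomous_coordinate (i : 'I_n) : autonomous 'X_i.
Proof. by exists 'X_i; rewrite map_mpolyX. Qed.

Lemma invariant_divisor_coordinate v (i : 'I_n) (g : {mpoly (ratfun C)[n]}) :
  v i = 'X_i * g -> invariant_divisor v 'X_i.
Proof.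
have X0 : 'X_i = 'X_i - (ratC (0 : C))%:MP :> {mpoly (ratfun C)[n]}.
  by rewrite /ratC polyC0 tofrac0 mpolyC0 subr0.
by rewrite X0; apply: invariant_divisor_hyperplane.
Qed.

End AutonomousDivisors.

(** * Factors of the right-hand sides *)

Section Factorizations.
Variables (A : comNzRingType) (eta a0 a1 a2 a3 a4 x y z : A).

Lemma D4_P_a0 : 2 * a2 + 3 * a1 = 1 ->
  D4_P eta 0 a1 a2 a1 a1 x y z =
  (x - eta)
  * (- 2 * x * (y - 1) * y * z * (2 * x - 2 * y + 1 - eta)
     + a1 * (2 * x - 2 * y + 1 - eta) * (2 * x * y + y ^+ 2 - x - y)
     + x * ((x - y) * (x - 3 * y + 2 - eta) + (1 - eta) * (1 - y))).
Proof.
(* Since 2 and 3 are coprime, the solutions of 2 a2 + 3 a1 = 1 have an integral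
   parametrization by u = a1 + a2; solving for a2 would divide by 2. *)
move=> rel; set u := a1 + a2.
have -> : a1 = 1 - 2 * u.
  by apply: (canRL (addrK _)); rewrite -[RHS]rel /u; ring.
have -> : a2 = 3 * u - 1.
  by apply: (canRL (addrK _)); rewrite -[X in _ + X]rel /u; ring.
by rewrite /D4_P; ring.
Qed.

Lemma D4_R_a2 :
  D4_R eta a0 a1 0 a3 a4 x y z =
  z
  * ((2 * x - 2 * y + 1 - eta)
     * (2 * x ^+ 2 * y + 2 * x * y ^+ 2 - x ^+ 2 - eta * y ^+ 2
        - 2 * (eta + 1) * x * y + eta * (x + y)) * z
     + (- 2 * (a3 + a4) * x ^+ 3
        + 2 * (a0 + a1) * y ^+ 3
        + 2 * (a0 + a1 + 2 * a3 + 2 * a4) * x ^+ 2 * y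
        - 2 * (2 * a0 + 2 * a1 + a3 + a4) * x * y ^+ 2
        + (- (a0 + a1 + 4 * a3) + 3 * (a3 + a4) * eta) * x ^+ 2
        + (- 3 * (a0 + a1) + (4 * a0 + a3 + a4) * eta) * y ^+ 2
        - 4 * (- (a0 + a1 + a3) + (a0 + a3 + a4) * eta) * x * y
        + (- (a0 + a1 + 2 * a3) + 2 * (a0 + 2 * a3) * eta
           - (a3 + a4) * eta ^+ 2) * x
        + (a0 + a1 - 2 * (2 * a0 + a3) * eta
           + (2 * a0 + a3 + a4) * eta ^+ 2) * y
        - (a0 + a3) * (eta - 1) * eta)).
Proof. by rewrite /D4_R; ring. Qed.

(** When alpha_1, alpha_3 and alpha_4 vanish, P and Q are both governed by
    (x - y - eta)(x - y + 1 - eta) and 2x - 2y + 1 - eta, which keeps the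
    cofactors short. *)
Lemma D4_P_a134 : a0 + 2 * a2 = 1 ->
  D4_P eta a0 0 a2 0 0 x y z =
  x
  * ((x - y - eta) * (x - y + 1 - eta) * (x - 2 * y + 1)
     - 2 * y * (y - 1) * (2 * x - 2 * y + 1 - eta) * ((x - eta) * z + a2)).
Proof.
move=> rel; have a0E := canRL (addrK _) rel.
by rewrite /D4_P a0E; ring.
Qed.

Lemma D4_Q_a134 : a0 + 2 * a2 = 1 ->
  D4_Q eta a0 0 a2 0 0 x y z =
  y
  * ((y - 1)
     * ((x - y - eta) * (x - y + 1 - eta)
        + 2 * x * (2 * x - 2 * y + 1 - eta) * ((x - eta) * z + a2))).
Proof.
move=> rel; have a0E := canRL (addrK _) rel.
by rewrite /D4_Q a0E; ring.
Qed.

End Factorizations.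

(** * Divisors of the system *)

Section D4Divisors.
Variables (C : fieldType) (eta : C) (b : ratfun C) (a0 a1 a2 a3 a4 : C).
Local Notation x := (varx C).
Local Notation y := (vary C).
Local Notation z := (varz C).

Lemma constC0 : constC (0 : C) = 0.
Proof. by rewrite /constC /ratC polyC0 tofrac0 mpolyC0. Qed.

Lemma constC1 : constC (1 : C) = 1.
Proof. by rewrite /constC /ratC polyC1 tofrac1 mpolyC1. Qed.

Lemma constC_relation (m n : nat) (c d : C) :
  m%:R * c + n%:R * d = 1 -> m%:R * constC c + n%:R * constC d = 1.
Proof.
have transfer (B : nzRingType) (h : {rmorphism C -> B}) :
    m%:R * c + n%:R * d = 1 -> m%:R * h c + n%:R * h d = 1.
  by move=> rel; rewrite -[RHS](rmorph1 h) -rel rmorphD !rmorphM !rmorph_nat.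
exact: (transfer {mpoly (ratfun C)[3]}
  (@mpolyC 3 (ratfun C) \o (@tofrac {poly C} \o polyC))).
Qed.

(** In the proofs below the cofactor is left open and read off from the
    factorization of the component of the vector field. *)
Lemma invariant_divisor_x_eta : 2 * a2 + 3 * a1 = 1 ->
  invariant_divisor (D4_system eta b 0 a1 a2 a1 a1) (x - constC eta).
Proof.
move=> /constC_relation rel; eapply invariant_divisor_hyperplane.
rewrite /D4_system (tnth_nth 0) /= constC0 (D4_P_a0 _ _ _ _ rel) scalerAr.
reflexivity.
Qed.

Lemma invariant_divisor_z :
  invariant_divisor (D4_system eta b a0 a1 0 a3 a4) z.
Proof.
eapply invariant_divisor_coordinate.
rewrite /D4_system (tnth_nth 0) /= constC0 D4_R_a2 scalerAr.
reflexivity.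
Qed.

Lemma invariant_divisor_xyy1 : a0 + 2 * a2 = 1 ->
  invariant_divisor (D4_system eta b a0 0 a2 0 0) (x * y * (y - 1)).
Proof.
move=> relC; have rel : constC a0 + 2 * constC a2 = 1.
  by rewrite -[constC a0]mul1r; apply: (@constC_relation 1 2); rewrite mul1r.
have xA : autonomous x := autonomous_coordinate _ _.
have yA : autonomous y := autonomous_coordinate _ _.
rewrite -constC1; apply: invariant_divisorM.
- exact: autonomousM.
- exact: autonomous_hyperplane.
- apply: invariant_divisorM; [exact: xA | exact: yA | |];
    eapply invariant_divisor_coordinate;
    rewrite /D4_system (tnth_nth 0) /= constC0.
  + rewrite (D4_P_a134 _ _ _ _ rel) scalerAr.
    reflexivity.
  rewrite (D4_Q_a134 _ _ _ _ rel) scalerAr.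
  reflexivity.
eapply invariant_divisor_hyperplane; rewrite -/(constC 1) constC1.
rewrite /D4_system (tnth_nth 0) /= constC0.
rewrite (D4_Q_a134 _ _ _ _ rel) mulrCA scalerAr.
reflexivity.
Qed.

End D4Divisors.

Theorem proposition6p2 (R : realType) (eta : R[i]) (b : ratfun R[i])
    (alpha0 alpha1 alpha2 alpha3 alpha4 : R[i])
    (heta : eta != 0) (hb : b != 0)
    (halpha : alpha0 + alpha1 + 2 * alpha2 + alpha3 + alpha4 = 1)
    (h43 : alpha4 = alpha3) (h31 : alpha3 = alpha1) :
  let beta0 := alpha0 in
  let beta1 := alpha2 in
  let beta2 := alpha3 in
  let sys := D4_system eta b alpha0 alpha1 alpha2 alpha3 alpha4 in
  let x := varx R[i] in
  let y := vary R[i] in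
  let z := varz R[i] in
  [/\ beta0 + 2 * beta1 + 3 * beta2 = 1,
      beta0 = 0 -> invariant_divisor sys (x - constC eta),
      beta1 = 0 -> invariant_divisor sys z
    & beta2 = 0 -> invariant_divisor sys (x * y * (y - 1))].
Proof.
move: halpha; rewrite {}h43 {}h31 => halpha beta0 beta1 beta2 sys x y z.
have total : alpha0 + 2 * alpha2 + 3 * alpha1 = 1 by rewrite -[RHS]halpha; ring.
split=> [|a0E|a2E|a1E]; first exact: total.
- rewrite /sys [alpha0]a0E.
  by apply: invariant_divisor_x_eta; rewrite -[RHS]total [alpha0]a0E add0r.
- rewrite /sys [alpha2]a2E; exact: invariant_divisor_z.
- rewrite /sys [alpha1]a1E; apply: invariant_divisor_xyy1.
  by rewrite -[RHS]total [alpha1]a1E mulr0 addr0.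
Qed.
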